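(* Let $A$ be a unital associative $k$-algebra and $H$ a conilpotent bialgebra over $k$. For all $f,g\in\mathcal{U}(QSh(A),A)$ and $\varphi\in\mathcal{U}(H,A)$, $$(f\ast g)\odot\varphi=(f\odot\varphi)\ast(g\odot\varphi).$$
   Context: Everything is over a fixed field $k$ of characteristic $0$. Conilpotent: for a bialgebra $H$ with coproduct $\Delta$, counit $\eta$ and $H^+=\ker\eta$, the reduced coproduct on $H^+$ is $\Delta'(h)=\Delta(h)-1\otimes h-h\otimes 1$, with iterates $\Delta'^{[1]}=\mathrm{Id}$, $\Delta'^{[n+1]}=(\mathrm{Id}\otimes\Delta'^{[n]})\circ\Delta'$. $H$ is conilpotent if for each $h\in H^+$ there is $n\ge 1$ with $\Delta'^{[n]}(h)=0$. Convolution: for linear maps $f,g:H\to A$, $f\ast g=m_A\circ(f\otimes g)\circ\Delta$, with $m_A$ the product of $A$. $\mathcal{U}(H,A)$ is the set of linear maps $f:H\to A$ with $f(1_H)=1_A$. $QSh(A)$, for an associative (not necessarily unital) algebra $A$ with product $\cdot_A$: $QSh(A)=\bigoplus_{n\ge0}A^{\otimes n}$, $A^{\otimes0}=k$, with $a_1\otimes\cdots\otimes a_n$ written as the word $a_1\cdots a_n$; unit $1\in A^{\otimes 0}$; product $\star$ given by $1\star v=v\star1=v$, $av\star bw=a(v\star bw)+b(av\star w)+(a\cdot_Ab)(v\star w)$; coproduct the deconcatenation $\Delta(a_1\cdots a_s)=\sum_{r=0}^s(a_1\cdots a_r)\otimes(a_{r+1}\cdots a_s)$; counit zero on words of length $\ge1$.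 It is a conilpotent bialgebra. $\iota:H\to QSh(H^+)$ is $\iota(1)=1$, $\iota(h)=\sum_{n\ge1}\Delta'^{[n]}(h)$ for $h\in H^+$, with $\Delta'^{[n]}(h)\in(H^+)^{\otimes n}$. For $\varphi\in\mathcal{U}(H,A)$, $QSh(\varphi):QSh(H^+)\to QSh(A)$ is the linear map $1\mapsto1$, $h_1\cdots h_r\mapsto\varphi(h_1)\cdots\varphi(h_r)$ (a word in $QSh(A)$). For $f\in\mathcal{U}(QSh(A),A)$, $f\odot\varphi:=f\circ QSh(\varphi)\circ\iota\in\mathcal{U}(H,A)$. *)

(* Defs.v *)
From HB Require Import structures.
From mathcomp Require Import all_boot all_order all_algebra.
From mathcomp Require Import ring_quotient.
From mathcomp.multinomials Require Import freeg.
From mathcomp Require Import boolp classical_sets fsbigop.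

Set Implicit Arguments.
Unset Strict Implicit.
Unset Printing Implicit Defensive.

Import GRing.Theory.
Import Quotient(quot).
Local Open Scope ring_scope.

Inductive span (k : fieldType) (M : lmodType k) (R : M -> Prop) : M -> Prop :=
| span0 : span R 0
| spanS a x y : R x -> span R y -> span R (a *: x + y).

Section Presentation.
Variables (k : fieldType) (X : choiceType) (R : {freeg X / k} -> Prop).

Definition relspan : {pred {freeg X / k}} := fun x => `[< span R x >].

Lemma relspanD x y : span R x -> span R y -> span R (x + y).
Proof.
elim=> [|a r z Rr _ IH] Sy; first by rewrite add0r.
by rewrite -addrA; apply: spanS => //; apply: IH.
Qed.

Lemma relspanZ a x : span R x -> span R (a *: x).
Proof.
elim=> [|b r z Rr _ IH]; first by rewrite scaler0; exact: span0.
by rewrite scalerDr scalerA; apply: spanS.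
Qed.

Lemma relspan_submod : submod_closed relspan.
Proof.
split=> [|a x y /asboolP Sx /asboolP Sy]; apply/asboolP; first exact: span0.
by apply: relspanD => //; apply: relspanZ.
Qed.

HB.instance Definition _ :=
  GRing.isSubmodClosed.Build k {freeg X / k} relspan relspan_submod.

(* The k-module generated by X subject to the relations r = 0 for R r. *)
Definition presented : Type := (quot relspan).

HB.instance Definition _ := GRing.Zmodule.on presented.

Definition pres_pi (x : {freeg X / k}) : presented := \pi_(quot relspan)%qT x.

Lemma pres_piB : {morph pres_pi : x y / x - y}.
Proof. by move=> x y; exact: (raddfB (\pi_(quot relspan)%qT)). Qed.

Lemma pres_piD : {morph pres_pi : x y / x + y}.
Proof. by move=> x y; exact: (raddfD (\pi_(quot relspan)%qT)). Qed.

Lemma pres_pi_eq x y : span R (x - y) <-> pres_pi x = pres_pi y.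
Proof.
rewrite (_ : (pres_pi x = pres_pi y) <-> (x - y) \in relspan).
  by split => [|/asboolP //]; move/asboolP.
by rewrite Quotient.idealrBE; split=> [/eqP|/eqP].
Qed.

Lemma pres_reprK (x : presented) : pres_pi (repr x) = x.
Proof. exact: (@reprK _ (quot relspan)). Qed.

Definition pres_scale (a : k) (x : presented) : presented :=
  pres_pi (a *: repr x).

Lemma pres_pi_scale a x : pres_pi (a *: x) = pres_scale a (pres_pi x).
Proof.
apply/pres_pi_eq; rewrite -scalerBr; apply: relspanZ; apply/pres_pi_eq.
by rewrite pres_reprK.
Qed.

Lemma pres_scalerA a b x :
  pres_scale a (pres_scale b x) = pres_scale (a * b) x.
Proof. by rewrite -[x]pres_reprK -!pres_pi_scale scalerA. Qed.

Lemma pres_scale1r : left_id 1 pres_scale.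
Proof. by move=> x; rewrite -[x]pres_reprK -pres_pi_scale scale1r. Qed.

Lemma pres_scalerDr : right_distributive pres_scale +%R.
Proof.
move=> a x y; rewrite -[x]pres_reprK -[y]pres_reprK.
by rewrite -pres_piD -!pres_pi_scale scalerDr pres_piD.
Qed.

Lemma pres_scalerDl x : {morph pres_scale^~ x : a b / a + b}.
Proof.
by move=> a b; rewrite -[x]pres_reprK -!pres_pi_scale scalerDl pres_piD.
Qed.

HB.instance Definition _ := GRing.Zmodule_isLmodule.Build k presented
  pres_scalerA pres_scale1r pres_scalerDr pres_scalerDl.

Lemma pres_piZ a x : pres_pi (a *: x) = a *: pres_pi x.
Proof. exact: pres_pi_scale. Qed.

Definition pres_gen (x : X) : presented := pres_pi << x >>.

Lemma pres_gen_rel a x y z :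
  R (<< x >> - a *: << y >> - << z >>) ->
  pres_gen x = a *: pres_gen y + pres_gen z.
Proof.
move=> Rr; rewrite /pres_gen -pres_piZ -pres_piD; apply/pres_pi_eq.
by rewrite opprD addrA -[X in span _ X]scale1r -[_ *: _]addr0; apply: spanS;
  [exact: Rr|exact: span0].
Qed.

(* The linear map sending the generator x to phi x; meaningful when phi respects
   the relations, see pres_lift_linear and pres_liftE. *)
Definition pres_lift (W : lmodType k) (phi : X -> W) (t : presented) : W :=
  fglift phi (repr t).

Section Lift.
Variables (W : lmodType k) (phi : X -> W).

Lemma fgliftD x y : fglift phi (x + y) = fglift phi x + fglift phi y.
Proof.
have h := @lift_is_additive k X W phi.
by have := h x (- y); rewrite opprK => ->; have := h 0 y;
  rewrite sub0r => ->; have := h 0 0; rewrite !subrr => ->; rewrite sub0r opprK.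
Qed.

Lemma fglift0 : fglift phi 0 = 0.
Proof. by have := @lift_is_additive k X W phi 0 0; rewrite !subrr. Qed.

Lemma fgliftZ a x : fglift phi (a *: x) = a *: fglift phi x.
Proof.
have fgs (I : Type) (s : seq I) (F : I -> {freeg X / k}) :
    fglift phi (\sum_(i <- s) F i) = \sum_(i <- s) fglift phi (F i).
  by elim: s => [|i s IH]; rewrite ?big_nil ?fglift0 // !big_cons fgliftD IH.
rewrite -{2}[x]freeg_sumE fgs scaler_sumr.
rewrite [a *: x]/(fgscale a x) /fgscale fgs.
by apply: eq_bigr => i _; rewrite !liftU scalerA.
Qed.

Lemma fgliftN x : fglift phi (- x) = - fglift phi x.
Proof. by apply: (addIr (fglift phi x)); rewrite -fgliftD !addNr fglift0. Qed.

Hypothesis phiR : forall r, R r -> fglift phi r = 0.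

Lemma fglift_span x : span R x -> fglift phi x = 0.
Proof.
by elim=> [|a r y Rr _ IH]; rewrite ?fglift0 // fgliftD fgliftZ phiR // IH
  scaler0 addr0.
Qed.

Lemma pres_lift_pi x : pres_lift phi (pres_pi x) = fglift phi x.
Proof.
apply/eqP; rewrite -subr_eq0 -lift_is_additive; apply/eqP/fglift_span.
by apply/pres_pi_eq; rewrite pres_reprK.
Qed.

Lemma pres_lift_linear : linear (pres_lift phi).
Proof.
move=> a x y; rewrite -[x]pres_reprK -[y]pres_reprK.
by rewrite -pres_piZ -pres_piD !pres_lift_pi fgliftD fgliftZ.
Qed.

Lemma pres_liftE x : pres_lift phi (pres_gen x) = phi x.
Proof. by rewrite pres_lift_pi liftU scale1r. Qed.

End Lift.

Lemma pres_ind (P : presented -> Prop) :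
    P 0 -> (forall a x t, P t -> P (a *: pres_gen x + t)) -> forall t, P t.
Proof.
move=> P0 PS t; rewrite -[t]pres_reprK -[repr t]freeg_sumE.
elim: (dom _) => [|x s IH].
  rewrite big_nil (_ : pres_pi 0 = 0) //.
  by rewrite -[0 in LHS](subrr 0) pres_piB subrr.
rewrite big_cons pres_piD -[coeff x _]mulr1.
rewrite (_ : << _ *g x >> = coeff x (repr t) *: << x >>); last first.
  apply/eqP/freeg_eqP => y; rewrite coeffU mulr1 -[RHS]/(coeff y (fgscale _ _)).
  rewrite /fgscale domU1 big_seq1 !coeffU.
  by rewrite eqxx !mulr1.
rewrite pres_piZ; exact: PS.
Qed.

End Presentation.

Arguments pres_gen {k X R} x.
Arguments pres_lift {k X R W} phi t.

Lemma pres_linear_ext (k : fieldType) (X : choiceType)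
    (R : {freeg X / k} -> Prop) (W : lmodType k) (f g : presented R -> W) :
  linear f -> linear g -> (forall x, f (pres_gen x) = g (pres_gen x)) -> f =1 g.
Proof.
have lin0 (h : presented R -> W) : linear h -> h 0 = 0.
  move=> hl; have := hl (-1) 0 0.
  by rewrite scaler0 addr0 scaleN1r addNr.
move=> fl gl fg; elim/pres_ind => [|a x t IH]; first by rewrite !lin0.
by rewrite fl gl fg IH.
Qed.

Section Tensor.
Variables (k : fieldType) (U V : lmodType k).

Inductive tensor_rel : {freeg (U * V)%type / k} -> Prop :=
| tensor_rel_l a x y v :
    tensor_rel (<< (a *: x + y, v) >> - a *: << (x, v) >> - << (y, v) >>)
| tensor_rel_r a u x y :
    tensor_rel (<< (u, a *: x + y) >> - a *: << (u, x) >> - << (u, y) >>).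

Definition tensor : Type := presented tensor_rel.
HB.instance Definition _ := GRing.Lmodule.on tensor.

Definition tpure (u : U) (v : V) : tensor := pres_gen (u, v).

Definition bilin (W : lmodType k) (b : U -> V -> W) : Prop :=
  (forall v, linear (b^~ v)) /\ (forall u, linear (b u)).

Definition tlift (W : lmodType k) (b : U -> V -> W) : tensor -> W :=
  pres_lift (fun p : U * V => b p.1 p.2).

Lemma tpure_bilin : bilin tpure.
Proof.
split=> [v a x y|u a x y].
  exact: (pres_gen_rel (tensor_rel_l a x y v)).
exact: (pres_gen_rel (tensor_rel_r a u x y)).
Qed.

Section TLift.
Variables (W : lmodType k) (b : U -> V -> W).
Hypothesis b_bilin : bilin b.

Lemma tlift_rel r :
  tensor_rel r -> fglift (fun p : U * V => b p.1 p.2) r = 0.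
Proof.
case: b_bilin => bl br; case=> [a x y v|a u x y];
  by rewrite !(fgliftD, fgliftN, fgliftZ, liftU, scale1r) /= (bl, br) addrAC addrK subrr.
Qed.

Lemma tlift_linear : linear (tlift b).
Proof. exact: pres_lift_linear tlift_rel. Qed.

Lemma tliftE u v : tlift b (tpure u v) = b u v.
Proof. exact: (pres_liftE tlift_rel). Qed.

End TLift.

Lemma tensor_ext (W : lmodType k) (f g : tensor -> W) :
  linear f -> linear g -> (forall u v, f (tpure u v) = g (tpure u v)) -> f =1 g.
Proof. by move=> fl gl fg; apply: pres_linear_ext => // -[]. Qed.

End Tensor.

Arguments tensor {k} U%_type V%_type.

Notation "U ⊗ V" := (tensor U V) (at level 40, left associativity) : type_scope.
Notation "u ⊗ v" := (tpure u v) (at level 40, left associativity) : ring_scope.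

Definition tmap (k : fieldType) (U V U' V' : lmodType k)
    (f : U -> U') (g : V -> V') : U ⊗ V -> U' ⊗ V' :=
  tlift (fun u v => f u ⊗ g v).

(* The canonical isomorphism (U ⊗ V) ⊗ W -> U ⊗ (V ⊗ W). *)
Definition tassoc (k : fieldType) (U V W : lmodType k) :
    U ⊗ V ⊗ W -> U ⊗ (V ⊗ W) :=
  tlift (fun t w => tlift (fun u v => u ⊗ (v ⊗ w)) t).

(* The product (a ⊗ b)(a' ⊗ b') = aa' ⊗ bb' of the algebra A ⊗ B. *)
Definition tmul (k : fieldType) (A B : algType k) (s t : A ⊗ B) : A ⊗ B :=
  tlift (fun a b => tlift (fun a' b' => (a * a') ⊗ (b * b')) t) s.

(* In counitl and counitr, k ⊗ C and C ⊗ k are identified with C. *)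
HB.mixin Record Lmodule_isCoalgebra (k : fieldType) C of GRing.Lmodule k C := {
  comul : {linear C -> (C ⊗ C)%type};
  counit : {scalar C};
  comulA : forall c, tassoc (tmap comul idfun (comul c)) = tmap idfun comul (comul c);
  counitl : forall c, tlift (fun x y => counit x *: y) (comul c) = c;
  counitr : forall c, tlift (fun x y => counit y *: x) (comul c) = c
}.

#[short(type="coalgType")]
HB.structure Definition Coalgebra (k : fieldType) :=
  {C of GRing.Lmodule k C & Lmodule_isCoalgebra k C}.

HB.mixin Record Algebra_isBialgebra (k : fieldType) H
    of GRing.Algebra k H & Coalgebra k H := {
  comul1 : comul (1 : H) = 1 ⊗ 1;
  comulM : forall x y : H, comul (x * y) = tmul (comul x) (comul y);
  counit1 : counit (1 : H) = 1;
  counitM : forall x y : H, counit (x * y) = counit x * counit y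
}.

#[short(type="bialgType")]
HB.structure Definition Bialgebra (k : fieldType) :=
  {H of GRing.Algebra k H & Coalgebra k H & Algebra_isBialgebra k H}.

Section Words.
Variables (k : fieldType) (V : lmodType k).

Inductive word_rel : {freeg (seq V) / k} -> Prop :=
| WordRel u a x y v : word_rel (<< u ++ (a *: x + y) :: v >>
    - a *: << u ++ x :: v >> - << u ++ y :: v >>).

(* The direct sum over n of the tensor powers of V: the relations are homogeneous
   in the length, and word [:: a1, .., an] is the word a1 .. an of degree n. Only the
   coalgebra (deconcatenation) and the unit word [::] are given; they do not
   depend on a product on V, and convolution does not use the quasi-shuffle
   product. *)
Definition QSh : Type := presented word_rel.
HB.instance Definition _ := GRing.Lmodule.on QSh.

Definition word (w : seq V) : QSh := pres_gen w.

Definition multilin (W : lmodType k) (phi : seq V -> W) : Prop :=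
  forall u a x y v, phi (u ++ (a *: x + y) :: v)
    = a *: phi (u ++ x :: v) + phi (u ++ y :: v).

Definition wlift (W : lmodType k) (phi : seq V -> W) : QSh -> W := pres_lift phi.

Lemma word_multilin : multilin word.
Proof.
by move=> u a x y v; exact: (pres_gen_rel (WordRel u a x y v)).
Qed.

Section WLift.
Variables (W : lmodType k) (phi : seq V -> W).
Hypothesis phi_multilin : multilin phi.

Lemma wlift_rel r : word_rel r -> fglift phi r = 0.
Proof.
case=> u a x y v; rewrite !(fgliftD, fgliftN, fgliftZ, liftU, scale1r).
by rewrite phi_multilin addrAC addrK subrr.
Qed.

Lemma wlift_linear : linear (wlift phi).
Proof. exact: pres_lift_linear wlift_rel. Qed.

Lemma wliftE w : wlift phi (word w) = phi w.
Proof. exact: (pres_liftE wlift_rel). Qed.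

End WLift.

Lemma word_ext (W : lmodType k) (f g : QSh -> W) :
  linear f -> linear g -> (forall w, f (word w) = g (word w)) -> f =1 g.
Proof. exact: pres_linear_ext. Qed.

(* The map a ⊗ - from words of length n to words of length n + 1. *)
Definition wcons (a : V) : QSh -> QSh := wlift (fun w => word (a :: w)).

Definition deconc_word (w : seq V) : QSh ⊗ QSh :=
  \sum_(0 <= r < (size w).+1) word (take r w) ⊗ word (drop r w).

Definition deconc : QSh -> QSh ⊗ QSh := wlift deconc_word.

Definition wcounit : QSh -> k := wlift (fun w => (w == [::])%:R : k^o).

End Words.

Section LinearFacts.
Variables (k : fieldType) (U V W : lmodType k) (f : U -> V).
Hypothesis fl : linear f.

Lemma linD x y : f (x + y) = f x + f y.
Proof. by have := fl 1 x y; rewrite !scale1r. Qed.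

Lemma lin0 : f 0 = 0.
Proof. by apply: (addrI (f 0)); rewrite -linD !addr0. Qed.

Lemma linZ a x : f (a *: x) = a *: f x.
Proof. by have := fl a x 0; rewrite lin0 !addr0. Qed.

Lemma lin_sum (I : Type) (s : seq I) (F : I -> U) :
  f (\sum_(i <- s) F i) = \sum_(i <- s) f (F i).
Proof.
by elim: s => [|i s IH]; rewrite ?big_nil ?lin0 // !big_cons linD IH.
Qed.

Lemma lin_comp (g : V -> W) : linear g -> linear (fun x => g (f x)).
Proof. by move=> gl a x y; rewrite fl gl. Qed.

Lemma lin_add (g : U -> V) : linear g -> linear (fun x => f x + g x).
Proof. by move=> gl a x y /=; rewrite fl gl scalerDr addrACA. Qed.

Lemma lin_scale (c : k) : linear (fun x => c *: f x).
Proof. by move=> a x y; rewrite fl scalerDr !scalerA mulrC. Qed.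

End LinearFacts.

Section TensorFacts.
Variables (k : fieldType) (U V : lmodType k).

Lemma tpurePl a (x y : U) (v : V) : (a *: x + y) ⊗ v = a *: (x ⊗ v) + y ⊗ v.
Proof. by case: (tpure_bilin U V) => h _; exact: h. Qed.

Lemma tpurePr a (u : U) (x y : V) : u ⊗ (a *: x + y) = a *: (u ⊗ x) + u ⊗ y.
Proof. by case: (tpure_bilin U V) => _ h; exact: h. Qed.

Lemma tpureDl (x y : U) (v : V) : (x + y) ⊗ v = x ⊗ v + y ⊗ v.
Proof. by have := tpurePl 1 x y v; rewrite !scale1r. Qed.

Lemma tpureDr (u : U) (x y : V) : u ⊗ (x + y) = u ⊗ x + u ⊗ y.
Proof. by have := tpurePr 1 u x y; rewrite !scale1r. Qed.

Lemma tpure0l (v : V) : (0 : U) ⊗ v = 0.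
Proof. by apply: (addrI ((0 : U) ⊗ v)); rewrite -tpureDl !addr0. Qed.

Lemma tpure0r (u : U) : u ⊗ (0 : V) = 0.
Proof. by apply: (addrI (u ⊗ (0 : V))); rewrite -tpureDr !addr0. Qed.

Lemma tpureZl a (u : U) (v : V) : (a *: u) ⊗ v = a *: (u ⊗ v).
Proof. by have := tpurePl a u 0 v; rewrite tpure0l !addr0. Qed.

Lemma tpureZr a (u : U) (v : V) : u ⊗ (a *: v) = a *: (u ⊗ v).
Proof. by have := tpurePr a u v 0; rewrite tpure0r !addr0. Qed.

End TensorFacts.

Section TmapFacts.
Variables (k : fieldType) (U V U' V' : lmodType k).
Variables (f : U -> U') (g : V -> V').
Hypotheses (fl : linear f) (gl : linear g).

Lemma tmap_bil : bilin (fun u v => f u ⊗ g v).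
Proof.
by split=> [v a x y|u a x y]; rewrite (fl, gl) (tpurePl, tpurePr).
Qed.

Lemma tmap_linear : linear (tmap f g).
Proof. exact: tlift_linear tmap_bil. Qed.

Lemma tmapE u v : tmap f g (u ⊗ v) = f u ⊗ g v.
Proof. exact: (tliftE tmap_bil). Qed.

End TmapFacts.

Section AssocFacts.
Variables (k : fieldType) (U V W : lmodType k).

Lemma tassoc_bil1 (w : W) : bilin (fun (u : U) (v : V) => u ⊗ (v ⊗ w)).
Proof.
by split=> [v a x y|u a x y]; rewrite ?(tpurePl, tpurePr).
Qed.

Lemma tassoc_bil2 : bilin (fun (t : U ⊗ V) (w : W) =>
  tlift (fun u v => u ⊗ (v ⊗ w)) t).
Proof.
split=> [w|t a x y]; first exact: tlift_linear (tassoc_bil1 w).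
have l z := tlift_linear (tassoc_bil1 z).
elim/pres_ind: t => [|b [u v] t IH]; first by rewrite !(lin0 (l _)) scaler0 addr0.
rewrite !l IH -/(u ⊗ v) !(tliftE (tassoc_bil1 _)) !tpurePr.
rewrite !scalerDr !scalerA [b * a]mulrC -!addrA; congr (_ + _).
by rewrite addrCA.
Qed.

Lemma tassoc_linear : linear (@tassoc k U V W).
Proof. exact: tlift_linear tassoc_bil2. Qed.

Lemma tassocE (u : U) (v : V) (w : W) : tassoc (u ⊗ v ⊗ w) = u ⊗ (v ⊗ w).
Proof. by rewrite /tassoc (tliftE tassoc_bil2) (tliftE (tassoc_bil1 _)). Qed.

End AssocFacts.

Section Deconcatenation.
Variables (k : fieldType) (V : lmodType k).
Implicit Types (a : V) (w : seq V).

Lemma idl : linear (@idfun (QSh V)).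
Proof. by []. Qed.

Lemma wcons_multilin a : multilin (fun w => word (a :: w)).
Proof. by move=> u b x y v; rewrite -!cat_cons word_multilin. Qed.

Lemma wcons_linear a : linear (wcons a).
Proof. exact: wlift_linear (wcons_multilin a). Qed.

Lemma wconsE a w : wcons a (word w) = word (a :: w).
Proof. exact: (wliftE (wcons_multilin a)). Qed.

Lemma wcons_linearl (x : QSh V) : linear (fun a => wcons a x).
Proof.
move=> b a a'; pose f x := wcons (b *: a + a') x.
pose g (x : QSh V) := b *: wcons a x + wcons a' x.
suff fg : f =1 g by exact: fg.
apply: word_ext; first exact: wcons_linear.
  by apply: lin_add; [apply: lin_scale|]; exact: wcons_linear.
by move=> w; rewrite /f /g !wconsE -[_ :: w]cat0s word_multilin.
Qed.

Lemma deconc_wordS a w : deconc_word (a :: w) =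
  word [::] ⊗ word (a :: w) + tmap (wcons a) idfun (deconc_word w).
Proof.
rewrite /deconc_word big_nat_recl //= (lin_sum (tmap_linear (wcons_linear a) idl)).
congr (_ + _); apply: eq_bigr => r _.
by rewrite (tmapE (wcons_linear a) idl) wconsE.
Qed.

Lemma deconc_word_multilin : multilin (@deconc_word k V).
Proof.
elim=> [|c u IH] a x y v; last first.
  rewrite !cat_cons !deconc_wordS IH (tmap_linear (wcons_linear c) idl).
  by rewrite -!cat_cons word_multilin tpurePr scalerDr addrACA.
rewrite /= !deconc_wordS scalerDr -[_ :: v]cat0s word_multilin tpurePr.
rewrite addrACA; congr (_ + _).
rewrite /deconc_word !(lin_sum (tmap_linear (wcons_linear _) idl)).
rewrite scaler_sumr -big_split /=; apply: eq_bigr => r _.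
rewrite !(tmapE (wcons_linear _) idl) !wconsE -[_ :: _]cat0s word_multilin.
by rewrite tpurePl.
Qed.

Lemma deconc_linear : linear (@deconc k V).
Proof. exact: wlift_linear deconc_word_multilin. Qed.

Lemma deconcE w : deconc (word w) = deconc_word w.
Proof. exact: (wliftE deconc_word_multilin). Qed.

Lemma wcounit_multilin : multilin (fun w : seq V => (w == [::])%:R : k^o).
Proof.
by move=> u a x y v; case: u => [|b u] /=; rewrite scaler0 addr0.
Qed.

Lemma wcounit_scalar : scalar (@wcounit k V).
Proof. exact: (wlift_linear wcounit_multilin). Qed.

Lemma wcounitE w : wcounit (word w) = (w == [::])%:R.
Proof. exact: (wliftE wcounit_multilin). Qed.

HB.instance Definition _ := GRing.isLinear.Build k (QSh V) (QSh V ⊗ QSh V)%type *:%R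
  (@deconc k V) deconc_linear.
HB.instance Definition _ := GRing.isLinear.Build k (QSh V) k *%R
  (@wcounit k V) wcounit_scalar.

Lemma deconc_wcons a x :
  deconc (wcons a x) = word [::] ⊗ wcons a x + tmap (wcons a) idfun (deconc x).
Proof.
apply: (@word_ext _ _ _ (fun x => deconc (wcons a x))
  (fun x => word [::] ⊗ wcons a x + tmap (wcons a) idfun (deconc x))).
- exact (lin_comp (wcons_linear a) deconc_linear).
- apply: lin_add; first by move=> b y z; rewrite wcons_linear tpurePr.
  exact (lin_comp deconc_linear (tmap_linear (wcons_linear a) idl)).
- by move=> w; rewrite wconsE !deconcE deconc_wordS.
Qed.

Lemma tmap_wcons_deconc a (t : QSh V ⊗ QSh V) :
  tassoc (tmap (@deconc k V) idfun (tmap (wcons a) idfun t))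
  = word [::] ⊗ tmap (wcons a) idfun t
    + tmap (wcons a) idfun (tassoc (tmap (@deconc k V) idfun t)).
Proof.
have tDl := tmap_linear deconc_linear idl.
have tAl := @tassoc_linear k (QSh V) (QSh V) (QSh V).
have cl := wcons_linear a.
have tcl := tmap_linear cl idl.
have idl2 : linear (@idfun (QSh V ⊗ QSh V)) by [].
have tcl2 := tmap_linear cl idl2.
pose f (t : QSh V ⊗ QSh V) := tassoc (tmap (@deconc k V) idfun (tmap (wcons a) idfun t)).
pose g (t : QSh V ⊗ QSh V) := word [::] ⊗ tmap (wcons a) idfun t
    + tmap (wcons a) idfun (tassoc (tmap (@deconc k V) idfun t)).
suff fg : f =1 g by exact: fg.
apply: tensor_ext.
- exact (lin_comp (lin_comp tcl tDl) tAl).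
- apply: lin_add; last exact (lin_comp (lin_comp tDl tAl) tcl2).
  by move=> b x y; rewrite tcl tpurePr.
move=> u v; rewrite /f /g (tmapE cl idl) !(tmapE deconc_linear idl) /=.
rewrite deconc_wcons -[X in X ⊗ v]addrC -[X in X + _]scale1r tpurePl scale1r.
rewrite (linD tAl) tassocE addrC; congr (_ + _).
pose f' (s : QSh V ⊗ QSh V) := tassoc (tmap (wcons a) idfun s ⊗ v).
pose g' (s : QSh V ⊗ QSh V) := tmap (wcons a) idfun (tassoc (s ⊗ v)).
suff fg : f' =1 g' by exact: fg.
apply: tensor_ext => [b x y|b x y|x y]; rewrite /f' /g'.
- by rewrite tcl tpurePl tAl.
- by rewrite tpurePl tAl tcl2.
- by rewrite (tmapE cl idl) !tassocE (tmapE cl idl2).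
Qed.

Lemma tmap_wcons_deconcr a (t : QSh V ⊗ QSh V) :
  tmap idfun (@deconc k V) (tmap (wcons a) idfun t)
  = tmap (wcons a) idfun (tmap idfun (@deconc k V) t).
Proof.
have tDr := tmap_linear idl deconc_linear.
have cl := wcons_linear a.
have idl2 : linear (@idfun (QSh V ⊗ QSh V)) by [].
pose f (t : QSh V ⊗ QSh V) := tmap idfun (@deconc k V) (tmap (wcons a) idfun t).
pose g (t : QSh V ⊗ QSh V) := tmap (wcons a) idfun (tmap idfun (@deconc k V) t).
suff fg : f =1 g by exact: fg.
apply: tensor_ext.
- exact (lin_comp (tmap_linear cl idl) tDr).
- exact (lin_comp tDr (tmap_linear cl idl2)).
- by move=> u v; rewrite /f /g (tmapE cl idl) !(tmapE idl deconc_linear)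
    (tmapE cl idl2).
Qed.

Lemma deconcA (x : QSh V) :
  tassoc (tmap (@deconc k V) idfun (deconc x)) = tmap idfun (@deconc k V) (deconc x).
Proof.
have tDl := tmap_linear deconc_linear idl.
have tDr := tmap_linear idl deconc_linear.
have tAl := @tassoc_linear k (QSh V) (QSh V) (QSh V).
pose f (x : QSh V) := tassoc (tmap (@deconc k V) idfun (deconc x)).
pose g (x : QSh V) := tmap idfun (@deconc k V) (deconc x).
suff fg : f =1 g by exact: fg.
apply: word_ext.
- exact (lin_comp (lin_comp deconc_linear tDl) tAl).
- exact (lin_comp deconc_linear tDr).
have d0 : deconc (word [::]) = word [::] ⊗ word [::] :> QSh V ⊗ QSh V.
  by rewrite deconcE /deconc_word big_nat1.
move=> w; rewrite /f /g; elim: w => [|a w IH].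
  by rewrite d0 (tmapE deconc_linear idl) (tmapE idl deconc_linear) d0 tassocE.
rewrite deconcE deconc_wordS -deconcE !(linD tDl, linD tDr, linD tAl).
rewrite tmap_wcons_deconc tmap_wcons_deconcr IH addrA; congr (_ + _).
rewrite (tmapE deconc_linear idl) (tmapE idl deconc_linear) d0 tassocE.
rewrite [deconc (word (a :: w))]deconcE deconc_wordS -deconcE.
by rewrite -[X in _ = _ ⊗ (X + _)]scale1r tpurePr scale1r.
Qed.

Lemma wcounitl (x : QSh V) :
  tlift (fun y z : QSh V => wcounit y *: z) (deconc x) = x.
Proof.
have bl : bilin (fun y z : QSh V => wcounit y *: z).
  split=> [z b u v|u b y z]; first by rewrite wcounit_scalar scalerDl scalerA.
  by rewrite scalerDr !scalerA mulrC.
pose f (x : QSh V) := tlift (fun y z : QSh V => wcounit y *: z) (deconc x).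
suff fg : f =1 idfun by exact: fg.
apply: word_ext => //; first exact (lin_comp deconc_linear (tlift_linear bl)).
move=> w; rewrite /f deconcE /deconc_word (lin_sum (tlift_linear bl)).
rewrite big_nat_recl //= big1_seq ?addr0 => [|r].
  by rewrite (tliftE bl) take0 drop0 wcounitE scale1r.
rewrite mem_index_iota /= => rw; rewrite (tliftE bl) wcounitE.
by case: w rw => [|a w] //= _; rewrite scale0r.
Qed.

Lemma wcounitr (x : QSh V) :
  tlift (fun y z : QSh V => wcounit z *: y) (deconc x) = x.
Proof.
have bl : bilin (fun y z : QSh V => wcounit z *: y).
  split=> [u b y z|z b u v]; last by rewrite wcounit_scalar scalerDl scalerA.
  by rewrite scalerDr !scalerA mulrC.
pose f (x : QSh V) := tlift (fun y z : QSh V => wcounit z *: y) (deconc x).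
suff fg : f =1 idfun by exact: fg.
apply: word_ext => //; first exact (lin_comp deconc_linear (tlift_linear bl)).
move=> w; rewrite /f deconcE /deconc_word (lin_sum (tlift_linear bl)).
rewrite big_nat_recr //= big1_seq ?add0r => [|r].
  by rewrite (tliftE bl) take_size drop_size wcounitE scale1r.
rewrite mem_index_iota /= => rw; rewrite (tliftE bl) wcounitE.
by rewrite -size_eq0 size_drop subn_eq0 leqNgt rw scale0r.
Qed.

HB.instance Definition _ := Lmodule_isCoalgebra.Build k (QSh V)
  deconcA wcounitl wcounitr.

End Deconcatenation.

Section Augmentation.
Variables (k : fieldType) (H : bialgType k).

Definition augm_pred : {pred H} := fun h => counit h == 0.

Lemma augm_submod : submod_closed augm_pred.
Proof.
split=> [|a x y /eqP x0 /eqP y0]; apply/eqP; first exact: linear0.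
by rewrite linearP x0 y0 mulr0 addr0.
Qed.

HB.instance Definition _ := GRing.isSubmodClosed.Build k H augm_pred augm_submod.

(* The augmentation ideal H^+. *)
Record augm := Augm { augm_val : H; augm_valP : augm_val \in augm_pred }.

HB.instance Definition _ := [isSub for augm_val].
HB.instance Definition _ := [Choice of augm by <:].
HB.instance Definition _ := [SubChoice_isSubLmodule of augm by <:].

Lemma augm_proj_subproof (h : H) : h - counit h *: 1 \in augm_pred.
Proof.
apply/eqP; rewrite linearB linearZ /=.
by rewrite counit1 mulr1 subrr.
Qed.

(* The projection of H = k 1 ⊕ H^+ onto H^+. *)
Definition augm_proj (h : H) : augm := Augm (augm_proj_subproof h).

Definition redcomul_val (h : augm) : H ⊗ H :=
  comul (val h) - 1 ⊗ val h - val h ⊗ 1.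

(* redcomul_val takes its values in H^+ ⊗ H^+, and redcomul is its
   corestriction: see redcomulE and augm_tensor_inj. *)
Definition redcomul (h : augm) : augm ⊗ augm :=
  tmap augm_proj augm_proj (redcomul_val h).

Lemma augm_proj_linear : linear augm_proj.
Proof.
move=> a x y; apply: val_inj; rewrite linearP /= linearP /=.
by rewrite scalerDl opprD -scalerA scalerBr addrACA.
Qed.

Lemma augm_val_linear : linear (val : augm -> H).
Proof. exact: linearP. Qed.

Lemma augm_valK : cancel (val : augm -> H) augm_proj.
Proof.
move=> h; apply: val_inj => /=.
by have /eqP -> := augm_valP h; rewrite scale0r subr0.
Qed.

Lemma augm_tensor_inj :
  injective (tmap (val : augm -> H) (val : augm -> H)).
Proof.
have vl := tmap_linear augm_val_linear augm_val_linear.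
have pl := tmap_linear augm_proj_linear augm_proj_linear.
apply: (@can_inj _ _ _ (tmap augm_proj augm_proj)) => t.
pose f (t : augm ⊗ augm) := tmap augm_proj augm_proj
  (tmap (val : augm -> H) (val : augm -> H) t).
suff fg : f =1 idfun by exact: fg.
apply: tensor_ext => //; first exact (lin_comp vl pl).
move=> u v; rewrite /f (tmapE augm_val_linear augm_val_linear).
by rewrite (tmapE augm_proj_linear augm_proj_linear) !augm_valK.
Qed.

Lemma redcomulE (h : augm) : tmap val val (redcomul h) = redcomul_val h.
Proof.
have vl := augm_val_linear; have pl := augm_proj_linear.
pose l (t : H ⊗ H) := tlift (fun x y : H => counit x *: y) t.
pose r (t : H ⊗ H) := tlift (fun x y : H => counit y *: x) t.
have bl : bilin (fun x y : H => counit x *: y).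
  split=> [y a x x'|x a y y']; first by rewrite linearP scalerDl scalerA.
  by rewrite scalerDr !scalerA mulrC.
have br : bilin (fun x y : H => counit y *: x).
  split=> [y a x x'|x a y y']; last by rewrite linearP scalerDl scalerA.
  by rewrite scalerDr !scalerA mulrC.
have ll : linear l := tlift_linear bl.
have lr : linear r := tlift_linear br.
have lE x y : l (x ⊗ y) = counit x *: y := tliftE bl x y.
have rE x y : r (x ⊗ y) = counit y *: x := tliftE br x y.
pose f (t : H ⊗ H) := tmap (val : augm -> H) (val : augm -> H)
  (tmap augm_proj augm_proj t).
pose g (t : H ⊗ H) := t + (-1) *: (1 ⊗ l t) + (-1) *: (r t ⊗ 1)
  + counit (l t) *: (1 ⊗ 1).
have fg : f =1 g.
  apply: tensor_ext => [||u v].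
  - exact (lin_comp (tmap_linear pl pl) (tmap_linear vl vl)).
  - have l1 : linear (fun t : H ⊗ H => (1 : H) ⊗ l t).
      by move=> a x y; rewrite ll tpurePr.
    have l2 : linear (fun t : H ⊗ H => r t ⊗ (1 : H)).
      by move=> a x y; rewrite lr tpurePl.
    have l3 : linear (fun t : H ⊗ H => counit (l t) *: (1 ⊗ 1 : H ⊗ H)).
      by move=> a x y; rewrite ll linearP scalerDl scalerA.
    apply: lin_add l3; apply: lin_add (lin_scale l2 _).
    by apply: lin_add (lin_scale l1 _).
  - rewrite /f /g (tmapE pl pl) (tmapE vl vl) lE rE /=.
    rewrite -!scaleNr tpureDl !tpureDr !tpureZl !tpureZr !scalerA linearZ /=.
    by rewrite !mulN1r -!addrA; congr (_ + _); rewrite addrCA mulrNN mulrC.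
rewrite /redcomul -/(f _) fg /g.
have e0 : counit (val h) = 0 by apply/eqP; exact: (augm_valP h).
have dl : l (redcomul_val h) = 0.
  rewrite /redcomul_val -!scaleN1r !(linD ll) !(linZ ll) [l (comul _)]counitl !lE.
  by rewrite counit1 e0 scale1r scale0r scaler0 addr0 scaleN1r subrr.
have dr : r (redcomul_val h) = 0.
  rewrite /redcomul_val -!scaleN1r !(linD lr) !(linZ lr) [r (comul _)]counitr !rE.
  by rewrite counit1 e0 scale1r scale0r scaler0 addr0 scaleN1r subrr.
by rewrite dl dr tpure0l tpure0r !scaler0 linear0 scale0r !addr0.
Qed.

Lemma redcomul_linear : linear redcomul.
Proof.
have l : linear redcomul_val.
  have l1 : linear (fun h : augm => (-1) *: ((1 : H) ⊗ val h)).
    by apply: lin_scale => a x y; rewrite augm_val_linear tpurePr.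
  have l2 : linear (fun h : augm => (-1) *: (val h ⊗ (1 : H))).
    by apply: lin_scale => a x y; rewrite augm_val_linear tpurePl.
  have l0 : linear (fun h : augm => comul (val h : H)).
    by move=> a x y; rewrite augm_val_linear linearP.
  move=> a x y; have := lin_add (lin_add l0 l1) l2 a x y.
  by rewrite /redcomul_val !scaleN1r.
exact (lin_comp l (tmap_linear augm_proj_linear augm_proj_linear)).
Qed.

(* redcomul_iter n is the iterate Δ'^[n+1]; it takes its values in
   (H^+)^(⊗ n+1), seen inside QSh augm. *)
Fixpoint redcomul_iter (n : nat) : augm -> QSh augm :=
  if n is n'.+1 then
    fun h => tlift (fun h1 h2 => wcons h1 (redcomul_iter n' h2)) (redcomul h)
  else fun h => word [:: h].

Lemma redcomul_iter_linear n : linear (redcomul_iter n).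
Proof.
elim: n => [|n IH] /=; first by move=> a x y; have := word_multilin [::] a x y [::].
have b : bilin (fun h1 h2 => wcons h1 (redcomul_iter n h2)).
  split=> [h|h]; first exact: wcons_linearl.
  exact (lin_comp IH (wcons_linear h)).
exact (lin_comp redcomul_linear (tlift_linear b)).
Qed.

(* The index n of redcomul_iter stands for n + 1 >= 1. *)
Definition conilpotent : Prop :=
  forall h : augm, exists n : nat, redcomul_iter n h = 0.

(* \sum_(n \in [set: nat]) is the sum of a finitely supported family, and is 0
   on a family with infinite support. *)
Definition iota_augm (h : augm) : QSh augm :=
  \sum_(n \in [set: nat]) redcomul_iter n h.

Definition iotaH (h : H) : QSh augm :=
  counit h *: word [::] + iota_augm (augm_proj h).

Lemma iotaH1 : iotaH 1 = word [::].
Proof.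
have p1 : augm_proj 1 = 0.
  by apply: val_inj => /=; rewrite counit1 scale1r subrr.
rewrite /iotaH counit1 scale1r p1 /iota_augm fsbig1 ?addr0 // => n _.
exact: (lin0 (redcomul_iter_linear n)).
Qed.

Lemma iotaH_augm (h : augm) : iotaH (val h) = iota_augm h.
Proof.
rewrite /iotaH augm_valK; have /eqP -> := augm_valP h.
by rewrite scale0r add0r.
Qed.

End Augmentation.

Definition QSh_map (k : fieldType) (V W : lmodType k) (phi : V -> W) :
  QSh V -> QSh W := wlift (fun w => word (map phi w)).

(* f ∗ g = m_A o (f ⊗ g) o Δ. *)
Definition conv (k : fieldType) (C : coalgType k) (A : algType k)
    (f g : C -> A) (c : C) : A :=
  tlift (fun a b : A => a * b) (tmap f g (comul c)).

Definition odot (k : fieldType) (H : bialgType k) (A : algType k)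
    (f : QSh A -> A) (phi : H -> A) (h : H) : A :=
  f (QSh_map (phi \o val) (iotaH h)).

Notation "f ∗ g" := (conv f g) (at level 40, left associativity) : ring_scope.
Notation "f ⊙ phi" := (odot f phi) (at level 40, left associativity) : ring_scope.

(* Main.v *)
(* Both QSh(phi) and iota are morphisms of coalgebras, so f ⊙ phi is f composed
   with a coalgebra morphism, and composing with such a morphism is compatible
   with convolution.  For iota this rests on
     Δ(Δ'^[n] h) = 1 ⊗ Δ'^[n] h + Δ'^[n] h ⊗ 1
                   + sum_(i + j = n) (Δ'^[i] ⊗ Δ'^[j]) (Δ' h),
   an identity valid without conilpotency, which follows from the
   coassociativity of Δ' by induction on n.  Conilpotency is used only to sum it
   over n: a given tensor in H^+ ⊗ H^+ is a finite sum of u ⊗ v, and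
   Δ'^[n] u = Δ'^[n] v = 0 for n large, so only finitely many pairs (i, j) matter. *)
Require Import Defs.
From HB Require Import structures.
From mathcomp Require Import all_boot all_order all_algebra.
From mathcomp Require Import zify.
From mathcomp Require Import boolp classical_sets fsbigop.

Set Implicit Arguments.
Unset Strict Implicit.
Unset Printing Implicit Defensive.

Import GRing.Theory.
Local Open Scope ring_scope.

(** * Linear and bilinear maps on tensor products *)

Lemma lin_bigsum (k : fieldType) (U W : lmodType k) (I : Type) (s : seq I) (F : I -> U -> W) :
  (forall i, linear (F i)) -> linear (fun x => \sum_(i <- s) F i x).
Proof.
move=> Fl a x y; rewrite scaler_sumr -big_split /=.
by apply: eq_bigr => i _; rewrite Fl.
Qed.

Lemma tpure_linearl (k : fieldType) (U V : lmodType k) (v : V) :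
  linear (fun u : U => u ⊗ v).
Proof. by move=> a x y; rewrite tpurePl. Qed.

Lemma tpure_linearr (k : fieldType) (U V : lmodType k) (u : U) :
  linear (fun v : V => u ⊗ v).
Proof. by move=> a x y; rewrite tpurePr. Qed.

Section TensorMaps.
Variables (k : fieldType) (U V : lmodType k).

Lemma bilin_comp (U' V' W : lmodType k) (b : U -> V -> W)
    (f : U' -> U) (g : V' -> V) :
  bilin b -> linear f -> linear g -> bilin (fun u v => b (f u) (g v)).
Proof.
by move=> [bl br] fl gl; split=> [v a x y|u a x y]; rewrite (fl, gl) (bl, br).
Qed.

Lemma lin_bilin (W W' : lmodType k) (F : W -> W') (b : U -> V -> W) :
  linear F -> bilin b -> bilin (fun u v => F (b u v)).
Proof.
by move=> Fl [bl br]; split=> [v a x y|u a x y]; rewrite (bl, br) Fl.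
Qed.

Lemma lin_tlift (W W' : lmodType k) (F : W -> W') (b : U -> V -> W) t :
  linear F -> bilin b -> F (tlift b t) = tlift (fun u v => F (b u v)) t.
Proof.
move=> Fl bb; have Fb := lin_bilin Fl bb.
apply: (@tensor_ext _ _ _ _ (fun t => F (tlift b t))).
- exact: (lin_comp (tlift_linear bb) Fl).
- exact: tlift_linear.
- by move=> u v; rewrite (tliftE bb) (tliftE Fb).
Qed.

Lemma eq_tlift (W : lmodType k) (b b' : U -> V -> W) t :
  (forall u v, b u v = b' u v) -> tlift b t = tlift b' t.
Proof.
by move=> e; congr (tlift _ t); apply/funext => u; apply/funext => v.
Qed.

Lemma tlift_tmap (U' V' W : lmodType k) (f : U -> U') (g : V -> V')
    (b : U' -> V' -> W) t : linear f -> linear g -> bilin b ->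
  tlift b (tmap f g t) = tlift (fun u v => b (f u) (g v)) t.
Proof.
move=> fl gl bb; rewrite /tmap (lin_tlift _ (tlift_linear bb) (tmap_bil fl gl)).
by apply: eq_tlift => u v; rewrite (tliftE bb).
Qed.

Lemma tmap_comp (U1 V1 U2 V2 : lmodType k) (f : U -> U1) (g : V -> V1)
    (f' : U1 -> U2) (g' : V1 -> V2) t :
  linear f -> linear g -> linear f' -> linear g' ->
  tmap f' g' (tmap f g t) = tmap (f' \o f) (g' \o g) t.
Proof.
by move=> fl gl fl' gl'; rewrite {1}/tmap (tlift_tmap _ fl gl (tmap_bil fl' gl')).
Qed.

Lemma bilin_add (W : lmodType k) (b b' : U -> V -> W) :
  bilin b -> bilin b' -> bilin (fun u v => b u v + b' u v).
Proof.
by move=> [bl br] [bl' br']; split=> *; apply: lin_add.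
Qed.

Lemma tlift_add (W : lmodType k) (b b' : U -> V -> W) t :
  bilin b -> bilin b' -> tlift (fun u v => b u v + b' u v) t = tlift b t + tlift b' t.
Proof.
move=> bb bb'; have bs := bilin_add bb bb'.
apply: (@tensor_ext _ _ _ _ _ (fun t => tlift b t + tlift b' t)).
- exact: tlift_linear.
- by apply: lin_add; exact: tlift_linear.
- by move=> u v; rewrite (tliftE bs) (tliftE bb) (tliftE bb').
Qed.

Lemma bilin_sum (I : Type) (s : seq I) (W : lmodType k) (b : I -> U -> V -> W) :
  (forall i, bilin (b i)) -> bilin (fun u v => \sum_(i <- s) b i u v).
Proof.
move=> bb; split=> z; apply: lin_bigsum => i; have [bl br] := bb i;
  [exact: bl | exact: br].
Qed.

Lemma tlift_sum (I : Type) (s : seq I) (W : lmodType k) (b : I -> U -> V -> W) t :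
  (forall i, bilin (b i)) ->
  tlift (fun u v => \sum_(i <- s) b i u v) t = \sum_(i <- s) tlift (b i) t.
Proof.
move=> bb; apply: (@tensor_ext _ _ _ _ _ (fun t => \sum_(i <- s) tlift (b i) t)).
- exact/tlift_linear/bilin_sum.
- by apply: lin_bigsum => i; apply: tlift_linear.
- move=> u v; rewrite (tliftE (bilin_sum s bb)).
  by apply: eq_bigr => i _; rewrite (tliftE (bb i)).
Qed.

End TensorMaps.

(** * Compatibility of QSh(phi) with deconcatenation *)

Section QShMap.
Variables (k : fieldType) (V W : lmodType k) (phi : V -> W).
Hypothesis phil : linear phi.

Lemma QSh_map_multilin : multilin (fun w => word (map phi w)).
Proof. by move=> u a x y v; rewrite !map_cat /= phil word_multilin. Qed.

Lemma QSh_map_linear : linear (QSh_map phi).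
Proof. exact: wlift_linear QSh_map_multilin. Qed.

Lemma QSh_map_word w : QSh_map phi (word w) = word (map phi w).
Proof. exact: (wliftE QSh_map_multilin). Qed.

(** A letterwise map commutes with taking prefixes and suffixes of words. *)
Lemma deconc_QSh_map x :
  deconc (QSh_map phi x) = tmap (QSh_map phi) (QSh_map phi) (deconc x).
Proof.
have ql := QSh_map_linear; have dl := @deconc_linear k.
apply: (@word_ext _ _ _ (fun x => deconc (QSh_map phi x))
  (fun x => tmap (QSh_map phi) (QSh_map phi) (deconc x))).
- exact: (lin_comp ql (dl W)).
- exact: (lin_comp (dl V) (tmap_linear ql ql)).
- move=> w; rewrite QSh_map_word !deconcE /deconc_word size_map.
  rewrite (lin_sum (tmap_linear ql ql)); apply: eq_bigr => r _.
  by rewrite (tmapE ql ql) !QSh_map_word map_take map_drop.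
Qed.

End QShMap.

(** * Coassociativity of the reduced coproduct *)

Section ReducedCoproduct.
Variables (k : fieldType) (H : bialgType k).
Let V : lmodType k := augm H.
Let D := @redcomul_iter k H.
Let Dl n : linear (D n) := @redcomul_iter_linear k H n.
Let pl := @augm_proj_linear k H.
Let rl := @redcomul_linear k H.

Lemma augm_proj1 : augm_proj (1 : H) = 0.
Proof. by apply: val_inj; rewrite /= counit1 scale1r subrr. Qed.

(* This holds on all of H, so coassociativity of Δ' is inherited from Δ. *)
Lemma redcomul_proj (h : H) :
  redcomul (augm_proj h) = tmap (@augm_proj k H) (@augm_proj k H) (comul h).
Proof.
have pE := tmapE pl pl; have tl := tmap_linear pl pl.
(* The projection kills 1, so every correction term with a factor 1 disappears. *)
rewrite /redcomul /redcomul_val -!scaleN1r !(linD tl, linZ tl, pE) augm_proj1.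
rewrite tpure0l tpure0r !scaler0 !addr0 /= linearB /= linearZ /= comul1.
by rewrite -scaleN1r !(linD tl, linZ tl, pE) augm_proj1 tpure0l !scaler0 addr0.
Qed.

(** The projection p of H onto H^+ is surjective and satisfies Δ' p = (p ⊗ p) Δ, so coassociativity
    descends along p. *)
Lemma redcomulA (h : V) :
  tassoc (tmap (@redcomul k H) idfun (redcomul h)) =
  tmap idfun (@redcomul k H) (redcomul h).
Proof.
have idV : linear (@idfun V) by [].
have idH : linear (@idfun H) by [].
have cl : linear (@comul k H) by exact: linearP.
have ppl := tmap_linear pl pl.
rewrite -[h]augm_valK redcomul_proj !tmap_comp //.
have -> : (@redcomul k H) \o (@augm_proj k H) =
    tmap (@augm_proj k H) (@augm_proj k H) \o (@comul k H).
  by apply/funext => x /=; rewrite redcomul_proj.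
have <- := @tmap_comp _ _ _ _ _ _ _ _ idfun _ _ (comul (val h)) cl idH ppl pl.
have <- := @tmap_comp _ _ _ _ _ _ _ _ _ _ _ (comul (val h)) idH cl pl ppl.
rewrite -comulA; move: (tmap _ _ (comul _)) => t.
(* What remains is naturality of [tassoc] with respect to [augm_proj], checked on pure tensors. *)
pose pp := tmap (@augm_proj k H) (@augm_proj k H).
apply: (@tensor_ext _ _ _ _ (fun t => tassoc (tmap pp (@augm_proj k H) t))
  (fun t => tmap (@augm_proj k H) pp (tassoc t))).
- exact: (lin_comp (tmap_linear ppl pl) (@tassoc_linear _ _ _ _)).
- exact: (lin_comp (@tassoc_linear _ _ _ _) (tmap_linear pl ppl)).
move=> s w; rewrite (tmapE ppl pl).
have al := @tassoc_linear k.
apply: (@tensor_ext _ _ _ _ (fun s => tassoc (pp s ⊗ augm_proj w))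
  (fun s => tmap (@augm_proj k H) pp (tassoc (s ⊗ w)))).
- exact (lin_comp (lin_comp ppl (@tpure_linearl _ _ _ _)) (al _ _ _)).
- exact (lin_comp (lin_comp (@tpure_linearl _ _ _ _) (al _ _ _)) (tmap_linear pl ppl)).
- by move=> u v; rewrite /pp (tmapE pl pl) !tassocE (tmapE pl ppl) (tmapE pl pl).
Qed.

(** * Iterates of Δ': persistence of vanishing, and deconcatenation *)

Lemma wcons_bilin : bilin (@wcons k V).
Proof. by split=> z; [exact: wcons_linearl | exact: wcons_linear]. Qed.

Lemma wcons_iter_bilin n : bilin (fun h1 h2 : V => wcons h1 (D n h2)).
Proof. by apply: (bilin_comp wcons_bilin) => //; exact: Dl. Qed.

Lemma redcomul_iterS n (h : V) :
  D n.+1 h = tlift (fun h1 h2 => wcons h1 (D n h2)) (redcomul h).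
Proof. by []. Qed.

(** [D 1 a] is Δ' a seen as a sum of two-letter words. The empty word has no last letter and gets
    the default 0. *)
Fixpoint redcomul_last_word (w : seq V) : QSh V :=
  match w with
  | [::] => 0
  | a :: w' => if w' is _ :: _ then wcons a (redcomul_last_word w') else D 1 a
  end.

Lemma redcomul_last_word_multilin : multilin redcomul_last_word.
Proof.
move=> u a x y v; elim: u => [|b u IH].
  case: v => [|c v]; first exact: Dl.
  exact: wcons_linearl.
(* The tail [u ++ z :: v] is never empty, so b is not the last letter. *)
have e z : redcomul_last_word ((b :: u) ++ z :: v) =
    wcons b (redcomul_last_word (u ++ z :: v)) by case: (u).
by rewrite !e IH wcons_linear.
Qed.

(* Applying Δ' to the last letter turns Δ'^[n] h into Δ'^[n+1] h, so that
   Δ'^[n] h = 0 forces all later iterates to vanish. *)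
Definition redcomul_last : QSh V -> QSh V := wlift redcomul_last_word.

Lemma redcomul_last_linear : linear redcomul_last.
Proof. exact: wlift_linear redcomul_last_word_multilin. Qed.

(** The letter b ensures that a is not the last letter, even on the degree 0 part of x. *)
Lemma redcomul_last_wcons2 a b x :
  redcomul_last (wcons a (wcons b x)) = wcons a (redcomul_last (wcons b x)).
Proof.
have ll := redcomul_last_linear; have cl := @wcons_linear k V.
have lE := wliftE redcomul_last_word_multilin.
apply: (@word_ext _ _ _ (fun x => redcomul_last (wcons a (wcons b x)))
  (fun x => wcons a (redcomul_last (wcons b x)))).
- exact: (lin_comp (lin_comp (cl b) (cl a)) ll).
- exact: (lin_comp (lin_comp (cl b) ll) (cl a)).
- by move=> w; rewrite !wconsE /redcomul_last !lE.
Qed.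

(** [D n h] has no part in degree 0: it is a sum of terms beginning with a letter, so a is never
    last. *)
Lemma redcomul_last_wcons a n h :
  redcomul_last (wcons a (D n h)) = wcons a (redcomul_last (D n h)).
Proof.
have ll := redcomul_last_linear; have cl := @wcons_linear k V.
case: n => [|n].
  by rewrite /= -[word [:: h]]wconsE redcomul_last_wcons2.
have b := wcons_iter_bilin n.
rewrite redcomul_iterS (lin_tlift _ (cl a) b).
rewrite (lin_tlift _ ll (lin_bilin (cl a) b)) (lin_tlift _ ll b).
rewrite (lin_tlift _ (cl a) (lin_bilin ll b)).
by apply: eq_tlift => u v; exact: redcomul_last_wcons2.
Qed.

(** The recursion always splits the right-hand factor, so the induction hypothesis applies behind
    the first letter. *)
Lemma redcomul_last_iter n h : redcomul_last (D n h) = D n.+1 h.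
Proof.
elim: n h => [|n IH] h.
  by rewrite /redcomul_last /= (wliftE redcomul_last_word_multilin).
rewrite redcomul_iterS (lin_tlift _ redcomul_last_linear (wcons_iter_bilin n)).
rewrite redcomul_iterS; apply: eq_tlift => u v.
by rewrite redcomul_last_wcons IH.
Qed.

Lemma redcomul_iter_eq0 m n h : (m <= n)%N -> D m h = 0 -> D n h = 0.
Proof.
move=> /subnK <- Dm0; elim: (n - m)%N => [|i IH] //.
by rewrite addSn -redcomul_last_iter IH (lin0 redcomul_last_linear).
Qed.

(** Since [D i] has degree i + 1, the i-th summand collects the cuts after i + 1 of the n + 1
    letters. The induction peels off the first letter. *)
Lemma deconc_redcomul_iter n h :
  deconc (D n h) = word [::] ⊗ D n h + D n h ⊗ word [::]
    + \sum_(i < n) tmap (D i) (D (n.-1 - i)) (redcomul h).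
Proof.
have dl := @deconc_linear k V; have cl := @wcons_linear k V.
have idQ := @idl k V.
elim: n h => [|n IH] h.
  rewrite big_ord0 addr0 /= deconcE /deconc_word /=.
  by rewrite big_nat_recl // big_nat1.
have b := wcons_iter_bilin n.
rewrite {1}redcomul_iterS (lin_tlift _ dl b).
(* [G i h1] is the i-th summand of the induction hypothesis with h1 put in front of its left
   factor. *)
pose G (i : nat) (h1 : V) (t : V ⊗ V) :=
  tmap (wcons h1) idfun (tmap (D i) (D (n.-1 - i)) t).
have tb : bilin (fun (h1 : V) (x : QSh V ⊗ QSh V) => tmap (wcons h1) idfun x).
  split=> [x|h1]; last exact: tmap_linear.
  move=> a u v.
  apply: (@tensor_ext _ _ _ _ (fun x => tmap (wcons (a *: u + v)) idfun x)
    (fun x => a *: tmap (wcons u) idfun x + tmap (wcons v) idfun x)).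
  - exact: tmap_linear.
  - by apply: lin_add; [apply: lin_scale|]; exact: tmap_linear.
  - by move=> x1 x2; rewrite !tmapE // wcons_linearl tpurePl.
have Gb i : bilin (G i).
  by apply: (bilin_comp tb) => //; exact (tmap_linear (Dl _) (Dl _)).
have l1 := @tpure_linearr k (QSh V) (QSh V) (word [::]).
have l3 := @tpure_linearl k (QSh V) (QSh V) (word [::]).
have b1 : bilin (fun h1 h2 : V => (word [::] : QSh V) ⊗ wcons h1 (D n h2)).
  exact (lin_bilin l1 b).
have b2 : bilin (fun h1 h2 : V => word [:: h1] ⊗ D n h2).
  exact: (tmap_bil (Dl 0) (Dl n)).
have b3 : bilin (fun h1 h2 : V => wcons h1 (D n h2) ⊗ (word [::] : QSh V)).
  exact (lin_bilin l3 b).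
have b4 (i : 'I_n) : bilin (fun h1 h2 : V => G i h1 (redcomul h2)).
  by apply: (bilin_comp (Gb i)).
(* The four kinds of cuts: before everything, after everything, just after the first letter, and
   further inside. *)
rewrite (eq_tlift (b' := fun h1 h2 => (word [::] ⊗ wcons h1 (D n h2) +
  wcons h1 (D n h2) ⊗ word [::]) +
  (word [:: h1] ⊗ D n h2 + \sum_(i < n) G i h1 (redcomul h2)))); last first.
  move=> u v; rewrite deconc_wcons IH.
  have tl' := tmap_linear (cl u) idQ.
  rewrite !(linD tl') (lin_sum tl') !(tmapE (cl u) idQ) wconsE /=.
  by rewrite -!addrA; congr (_ + _); rewrite addrCA.
rewrite (tlift_add _ (bilin_add b1 b3) (bilin_add b2 (bilin_sum _ b4))).
rewrite (tlift_add _ b1 b3) (tlift_add _ b2 (bilin_sum _ b4)) (tlift_sum _ _ b4).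
rewrite -(lin_tlift _ l1 b) -(lin_tlift _ l3 b) -redcomul_iterS; congr (_ + _).
(* The cut after the first letter is the summand 0; [G i] must give the summand i + 1. *)
rewrite big_ord_recl subn0; congr (_ + _); apply: eq_bigr => i _.
have idV : linear (@idfun V) by [].
(* Coassociativity moves the second Δ' to the left factor, where h1 and [D i] combine into
   [D i.+1]. *)
rewrite -(tlift_tmap _ idV rl (Gb i)) -redcomulA.
have -> : (n.+1.-1 - lift ord0 i = n.-1 - i)%N.
  by rewrite /= /bump add1n subnS -subn1 -subn1 subnAC.
have gl := tlift_linear (Gb i).
rewrite {1}/tmap (lin_tlift _ (@tassoc_linear _ _ _ _) (tmap_bil rl idV)).
rewrite (lin_tlift _ gl) ?[in RHS]/tmap; last first.
  exact: (lin_bilin (@tassoc_linear _ _ _ _) (tmap_bil rl idV)).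
apply: eq_tlift => u v; rewrite -/D (redcomul_iterS i u) /=.
move: (redcomul u) => s; have bi := wcons_iter_bilin i.
apply: (@tensor_ext _ _ _ _ (fun s => tlift (G i) (tassoc (s ⊗ v)))
  (fun s => tlift (fun h1 h2 : V => wcons h1 (D i h2)) s ⊗ D (n.-1 - i) v)).
- exact (lin_comp (lin_comp (@tpure_linearl _ _ _ _) (@tassoc_linear _ _ _ _)) gl).
- exact (lin_comp (tlift_linear bi) (@tpure_linearl _ _ _ _)).
- move=> x y; rewrite tassocE (tliftE (Gb i)) (tliftE bi) /G.
  by rewrite (tmapE (Dl _) (Dl _)) (tmapE (cl _) idQ).
Qed.


(** * Summation under conilpotency: iota is a coalgebra morphism *)

Hypothesis conilH : conilpotent H.

Lemma redcomul_iter_bound (h : V) : exists N, forall n, (N <= n)%N -> D n h = 0.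
Proof.
by have [N DN] := conilH h; exists N => n Nn; exact: redcomul_iter_eq0 DN.
Qed.

Lemma iota_augm_sum (h : V) N :
  (forall n, (N <= n)%N -> D n h = 0) -> iota_augm h = \sum_(n < N) D n h.
Proof.
move=> DN; rewrite (fsbig_ord _ N (fun n => D n h)).
apply/esym/fsbig_widen => // n /= [_ /negP]; rewrite -leqNgt; exact: DN.
Qed.

(** A common bound for x and y turns all three sums into finite sums over the same range. *)
Lemma iota_augm_linear : linear (@iota_augm k H).
Proof.
move=> a x y; have [N Nx] := redcomul_iter_bound x.
have [M My] := redcomul_iter_bound y.
have x0 n : (maxn N M <= n)%N -> D n x = 0.
  by rewrite geq_max => /andP[+ _]; exact: Nx.
have y0 n : (maxn N M <= n)%N -> D n y = 0.
  by rewrite geq_max => /andP[_]; exact: My.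
rewrite (iota_augm_sum x0) (iota_augm_sum y0) (iota_augm_sum (N := maxn N M)).
  exact: (lin_bigsum _ (fun n : 'I_(maxn N M) => Dl n)).
by move=> n Nn; rewrite Dl x0 // y0 // scaler0 addr0.
Qed.

(** With j = n - 1 - i, the left side sums over the triangle i + j + 1 < M + 0, and for M >= 2N this
    contains the square i, j < N outside which all terms vanish. *)
Lemma sum_redcomul_iter_pure (u v : V) N :
    (forall n, (N <= n)%N -> D n u = 0) -> (forall n, (N <= n)%N -> D n v = 0) ->
  forall M, (N + N <= M)%N ->
  \sum_(n < M) \sum_(i < n) tmap (D i) (D (n.-1 - i)) (u ⊗ v)
  = iota_augm u ⊗ iota_augm v.
Proof.
move=> u0 v0 M NM.
have sum_l (W : QSh V) : iota_augm u ⊗ W = \sum_(i < M) D i u ⊗ W.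
  rewrite (iota_augm_sum (N := M)) ?(lin_sum (@tpure_linearl _ _ _ W)) // => n Mn.
  by apply: u0; lia.
rewrite sum_l.
under eq_bigr => n _.
  under eq_bigr => i _ do rewrite (tmapE (Dl _) (Dl _)).
  (* The range of i is made independent of n so that the two sums can be exchanged. *)
  rewrite (big_ord_widen M (fun i => D i u ⊗ D (n.-1 - i)%N v)) ?(ltnW (ltn_ord n)) //.
  over.
rewrite (exchange_big_dep xpredT) //=; apply: eq_bigr => i _.
have [Ni|iN] := leqP N i.
  by rewrite u0 // tpure0l big1 // => *; rewrite tpure0l.
(* For i < N, the index j = n - (i + 1) runs over M - (i + 1) >= N values, enough for all of
   [iota_augm v]. *)
rewrite -(big_mkord (fun n => i < n)%N (fun n => D i u ⊗ D (n.-1 - i)%N v)).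
rewrite -(big_nat_widenl i.+1 0%N M xpredT) // -(add0n i.+1) big_addn big_mkord.
rewrite (iota_augm_sum (N := (M - i.+1)%N)) => [|n Mn]; last by apply: v0; lia.
rewrite (lin_sum (@tpure_linearr _ _ _ _)); apply: eq_bigr => j _.
by congr (_ ⊗ D _ v); lia.
Qed.

(** A tensor is a finite sum of pure ones, so the maximum of their bounds works. *)
Lemma sum_redcomul_iter (t : V ⊗ V) : exists N, forall M, (N <= M)%N ->
  \sum_(n < M) \sum_(i < n) tmap (D i) (D (n.-1 - i)) t
  = tmap (@iota_augm k H) (@iota_augm k H) t.
Proof.
have il := tmap_linear iota_augm_linear iota_augm_linear.
have sl M : linear (fun t : V ⊗ V =>
    \sum_(n < M) \sum_(i < n) tmap (D i) (D (n.-1 - i)) t).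
  by apply: lin_bigsum => n; apply: lin_bigsum => i; exact: tmap_linear (Dl _) (Dl _).
elim/pres_ind: t => [|a [u v] t [N IH]].
  by exists 0%N => M _; rewrite (lin0 (sl M)) (lin0 il).
have [Nu u0] := redcomul_iter_bound u; have [Nv v0] := redcomul_iter_bound v.
pose m := maxn Nu Nv.
exists (maxn N (m + m)) => M; rewrite geq_max => /andP[NM mM].
rewrite (sl M) IH // il; congr (_ *: _ + _); rewrite -/(u ⊗ v).
rewrite (tmapE iota_augm_linear iota_augm_linear).
apply: (@sum_redcomul_iter_pure u v m) => // n; rewrite geq_max => /andP[un vn].
  exact: u0.
exact: v0.
Qed.

Lemma deconc_iota_augm (h : V) : deconc (iota_augm h) =
  word [::] ⊗ iota_augm h + iota_augm h ⊗ word [::]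
  + tmap (@iota_augm k H) (@iota_augm k H) (redcomul h).
Proof.
have [N Nh] := redcomul_iter_bound h; have [M Mh] := sum_redcomul_iter (redcomul h).
(* One cut-off serves both the sum defining [iota_augm h] and the double sum over Δ' h. *)
rewrite -(Mh (maxn N M)) ?leq_maxr // (iota_augm_sum (N := maxn N M)); last first.
  by move=> n; rewrite geq_max => /andP[+ _]; exact: Nh.
rewrite (lin_sum (@deconc_linear k V)) (lin_sum (@tpure_linearr _ _ _ _)).
rewrite (lin_sum (@tpure_linearl _ _ _ _)) -!big_split /=.
by apply: eq_bigr => n _; rewrite deconc_redcomul_iter.
Qed.

Lemma iotaH_linear : linear (@iotaH k H).
Proof.
apply: lin_add; last exact (lin_comp pl iota_augm_linear).
by move=> a x y; rewrite linearP scalerDl scalerA.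
Qed.

Lemma deconc_iotaH (h : H) :
  deconc (iotaH h) = tmap (@iotaH k H) (@iotaH k H) (comul h).
Proof.
have il := iotaH_linear; have iil := tmap_linear il il; have vl := @augm_val_linear k H.
have dl := lin_comp il (@deconc_linear k V).
have dr : linear (fun h => tmap (@iotaH k H) (@iotaH k H) (comul h)).
  by apply: lin_comp iil; exact: linearP.
(* H = k 1 ⊕ H^+: the element 1 goes to the grouplike empty word, and on H^+ the three terms of Δ =
   Δ' + 1 ⊗ h + h ⊗ 1 match those of [deconc_iota_augm]. *)
have -> : h = counit h *: 1 + val (augm_proj h) by rewrite /= addrC subrK.
rewrite dl dr; congr (_ *: _ + _).
  rewrite comul1 (tmapE il il) iotaH1 deconcE /deconc_word big_nat1 //.
move: (augm_proj h) => a; rewrite iotaH_augm deconc_iota_augm.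
have -> : comul (val a) = tmap val val (redcomul a) + 1 ⊗ val a + val a ⊗ 1.
  by rewrite redcomulE /redcomul_val addrAC subrK subrK.
rewrite !(linD iil) !(tmapE il il) iotaH1 iotaH_augm (tmap_comp _ vl vl il il).
have -> : @iotaH k H \o val = @iota_augm k H.
  by apply/funext => x; exact: iotaH_augm.
by rewrite addrC addrA.
Qed.

End ReducedCoproduct.

Theorem proposition5 (k : fieldType) (char0 : [pchar k] =i pred0)
    (A : algType k) (H : bialgType k) (conilH : conilpotent H)
    (f g : {linear QSh A -> A}) (f1 : f (word [::]) = 1) (g1 : g (word [::]) = 1)
    (phi : {linear H -> A}) (phi1 : phi 1 = 1) :
  (f ∗ g) ⊙ phi =1 (f ⊙ phi) ∗ (g ⊙ phi).
Proof.
move=> h; have il := iotaH_linear conilH.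
have fl : linear f := linearP f; have gl : linear g := linearP g.
have phil : linear (phi \o (val : augm H -> H)).
  exact (lin_comp (@augm_val_linear k H) (linearP phi)).
have ql := QSh_map_linear phil.
have qil := lin_comp il ql.
(* Both coalgebra morphisms are pulled through the coproduct, after which the two sides apply the
   same maps to Δ h. *)
rewrite /odot /conv /comul /= (deconc_QSh_map phil) (deconc_iotaH conilH).
by rewrite (tmap_comp _ il il ql ql) (tmap_comp _ qil qil fl gl).
Qed.
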